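(* Let $(R,\vartriangleright)$ be a finite rack. Then every $\vartriangleright$-congruence on $R$ is a rack congruence.
   Context: A rack $(R,\vartriangleright)$ is a set $R$ with a binary operation $\vartriangleright$ that is right self-distributive, $(x\vartriangleright y)\vartriangleright z=(x\vartriangleright z)\vartriangleright(y\vartriangleright z)$ for all $x,y,z\in R$, and right invertible: for all $y,z\in R$ there is a unique $x\in R$ with $x\vartriangleright y=z$. The inverse rack operation $\vartriangleleft$ is the binary operation on $R$ determined by $(x\vartriangleright y)\vartriangleleft y=x$ and $(x\vartriangleleft y)\vartriangleright y=x$ for all $x,y\in R$. For a binary operation $*$ on a set $M$, an equivalence relation $\sim$ on $M$ is a $*$-congruence if $a\sim c$ and $b\sim d$ imply $a*b\sim c*d$, for all $a,b,c,d\in M$. A rack congruence on $R$ is an equivalence relation that is both a $\vartriangleright$-congruence and a $\vartriangleleft$-congruence. *)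

(* Defs.v *)
From Corelib Require Import RelationClasses.
From mathcomp Require Import all_boot.

Set Implicit Arguments.
Unset Strict Implicit.
Unset Printing Implicit Defensive.

(* [choiceType] only makes the inverse operation definable without axioms;
   every finite type is one. *)
Record rack (T : choiceType) := Rack {
  rack_op : T -> T -> T;
  rack_right_distr : forall x y z : T,
    rack_op (rack_op x y) z = rack_op (rack_op x z) (rack_op y z);
  rack_right_invertible : forall y z : T, exists! x : T, rack_op x y = z
}.

Lemma rack_right_div (T : choiceType) (R : rack T) (z y : T) :
  exists x : T, rack_op R x y == z.
Proof.
by case: (rack_right_invertible R y z) => x [xyz _]; exists x; apply/eqP.
Qed.

Definition rack_inv (T : choiceType) (R : rack T) (z y : T) : T :=
  xchoose (rack_right_div R z y).

Lemma rack_invK (T : choiceType) (R : rack T) (x y : T) :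
  rack_op R (rack_inv R x y) y = x.
Proof. exact/eqP/(xchooseP (rack_right_div R x y)). Qed.

Lemma rack_opK (T : choiceType) (R : rack T) (x y : T) :
  rack_inv R (rack_op R x y) y = x.
Proof.
have [u [_ uniq_u]] := rack_right_invertible R y (rack_op R x y).
by rewrite -(uniq_u _ (rack_invK R _ y)) -(uniq_u x).
Qed.

Definition is_congruence (M : Type) (op : M -> M -> M) (sim : M -> M -> Prop) :
  Prop :=
  Equivalence sim /\
  forall a b c d : M, sim a c -> sim b d -> sim (op a b) (op c d).

Definition is_rack_congruence (T : choiceType) (R : rack T)
    (sim : T -> T -> Prop) : Prop :=
  is_congruence (rack_op R) sim /\ is_congruence (rack_inv R) sim.

(* Main.v *)
Require Import Defs.
From mathcomp Require Import all_boot all_fingroup cyclic.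

(** On a finite rack, right translation by b is a permutation of a finite set,
    so its inverse is one of its powers with a natural number exponent: a <| b
    is obtained from a by applying (- |> b) some k times. A congruence for |>
    is preserved by such iterates, provided that the same k serves for both
    translations involved. All translations live in the finite symmetric group
    on T, so k can be the order of that group minus one
    ([iter_cancel_uniform], [rack_inv_iter]). *)

(** Lagrange's theorem in the symmetric group on [T] makes the exponent
    independent of [f]. *)
Lemma iter_cancel_uniform (T : finType) :
  exists k, forall f : T -> T, injective f -> cancel (iter k f) f.
Proof.
exists #|[set: {perm T}]|.-1 => f f_inj x.
rewrite -iterS prednK ?cardG_gt0 // -(eq_iter (permE f_inj)) -permX.
by rewrite expg_cardG ?inE // perm1.
Qed.

(** The exponent is chosen before [a] and [b], so that inverse translations by
    two congruent elements become iterates of the same length. *)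
Lemma rack_inv_iter (T : finType) (R : rack T) :
  exists k, forall a b, rack_inv R a b = iter k (rack_op R ^~ b) a.
Proof.
have [k iterK] := iter_cancel_uniform T.
have op_inj y : injective (rack_op R ^~ y).
  by apply: (can_inj (g := rack_inv R ^~ y)) => x; apply: rack_opK.
by exists k => a b; apply: (op_inj b); rewrite rack_invK (iterK _ (op_inj b)).
Qed.

Lemma congruence_iter (M : Type) (op : M -> M -> M) (sim : M -> M -> Prop) k
    (a b c d : M) :
  is_congruence op sim -> sim a c -> sim b d ->
  sim (iter k (op ^~ b) a) (iter k (op ^~ d) c).
Proof. by move=> [_ sim_op] sim_ac sim_bd; elim: k => //= k; move/sim_op; apply. Qed.

Theorem corollary3p12 (T : finType) (R : rack T) (sim : T -> T -> Prop) :
  is_congruence (rack_op R) sim -> is_rack_congruence R sim.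
Proof.
move=> sim_congr; split=> //; split; first by case: sim_congr.
have [k invE] := rack_inv_iter _ R.
by move=> a b c d sim_ac sim_bd; rewrite !invE; apply: congruence_iter.
Qed.
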